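(* Let $k,n$ be positive integers with $n\ge 2k+1$. Then the boxicity of the Kneser graph $Kn(k,n)$ satisfies $\mathrm{box}(Kn(k,n))\le n-2$. Moreover, if $k\ge 2$ and $n\ge 2k^3-2k^2+1$, then $$\mathrm{box}(Kn(k,n))\ \ge\ n-\frac{13k^2-11k+16}{2}.$$
   Context: An axis-parallel $d$-dimensional box is a cartesian product $I_1\times I_2\times\dots\times I_d$ where each $I_i$ is a closed sub-interval of the real line (the whole line $\mathbb R$ is allowed). For a finite graph $G=(V,E)$, the boxicity $\mathrm{box}(G)$ is the minimum dimension $d\geq 0$ such that $G$ is the intersection graph of a family $(B_v)_{v\in V}$ of $d$-dimensional axis-parallel boxes in $\mathbb R^d$, i.e. distinct $u,v\in V$ are adjacent if and only if $B_u\cap B_v\ne\varnothing$ (a complete graph has boxicity $0$). For positive integers $k,n$ with $n\ge 2k+1$, the Kneser graph $Kn(k,n)$ has as vertices all $k$-element subsets of $[n]=\{1,\dots,n\}$, two vertices being adjacent if the corresponding $k$-sets are disjoint. *)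

(* Defs.v *)
From HB Require Import structures.
From mathcomp Require Import all_boot all_order all_algebra.
From mathcomp Require Import all_classical all_reals all_analysis.
Import numFieldNormedType.Exports.
Import Order.TTheory GRing.Theory Num.Theory.

Set Implicit Arguments.
Unset Strict Implicit.
Unset Printing Implicit Defensive.

Local Open Scope classical_set_scope.
Local Open Scope ring_scope.

Record sgraph := SGraph {
  vertex :> finType;
  edge : rel vertex;
  edge_sym : symmetric edge;
  edge_irr : irreflexive edge }.

(* Closed half-lines and the whole line are included; the empty set is not. *)
Definition closed_interval (R : realType) (I : set R) : Prop :=
  [/\ I !=set0, is_interval I & closed I].

(* For d = 0 the only box is the single point of 'rV_0. *)
Definition is_box (R : realType) (d : nat) (B : set 'rV[R]_d) : Prop :=
  exists2 I : 'I_d -> set R,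
    (forall i, closed_interval (I i)) &
    B = [set x : 'rV[R]_d | forall i, I i (x ord0 i)].

Definition box_representation (R : realType) (d : nat) (G : sgraph)
    (B : G -> set 'rV[R]_d) : Prop :=
  (forall v, is_box (B v)) /\
  (forall u v : G, u != v -> (edge u v <-> (B u `&` B v) !=set0)).

Definition box_representable (R : realType) (G : sgraph) (d : nat) : Prop :=
  exists B : G -> set 'rV[R]_d, box_representation B.

Lemma closed_interval_itv (R : realType) (a b : R) :
  a <= b -> closed_interval `[a, b].
Proof.
move=> ab; split.
- by exists a; rewrite /= in_itv /= lexx.
- exact: interval_is_interval.
- exact: interval_closed.
Qed.

(* One coordinate per vertex w: w gets [0, 0], its neighbours [0, 1] and the
   other vertices [1, 1]. *)
Lemma box_representable_card (R : realType) (G : sgraph) :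
  box_representable R G #|G|.
Proof.
pose lo (w v : G) : R := if (v == w) || edge v w then 0 else 1.
pose hi (w v : G) : R := if v == w then 0 else 1.
have lohi w v : lo w v <= hi w v.
  by rewrite /lo /hi; case: (v == w) => //=; case: (edge v w).
exists (fun v => [set x : 'rV[R]_#|G| |
  forall i, `[lo (enum_val i) v, hi (enum_val i) v]%classic (x ord0 i)]).
split=> [v|u v uv].
  exists (fun i => `[lo (enum_val i) v, hi (enum_val i) v]%classic) => // i.
  exact: closed_interval_itv.
split=> [euv|[x [xu xv]]].
  exists (\row_i Num.min (hi (enum_val i) u) (hi (enum_val i) v)).
  have evu : edge v u by rewrite edge_sym.
  split=> i /=; rewrite mxE in_itv /= ge_min le_min lexx ?orbT andbT lohi ?andbT /=.
  all: rewrite /lo /hi.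
  - case: (eqVneq v (enum_val i)) => [<-|_]; first by rewrite euv orbT.
    by case: ifP.
  - case: (eqVneq u (enum_val i)) => [<-|_]; first by rewrite evu orbT.
    by case: ifP.
apply/negPn/negP => neuv.
move: (xu (enum_rank u)) (xv (enum_rank u)); rewrite /= !enum_rankK !in_itv /=.
rewrite /lo /hi eqxx (eq_sym v) (negbTE uv) edge_sym (negbTE neuv) /=.
move=> /andP[_ x0] /andP[x1 _].
by move: (le_trans x1 x0); rewrite ler10.
Qed.

Lemma box_representable_ex (R : realType) (G : sgraph) :
  exists d, `[< box_representable R G d >].
Proof. by exists #|G|; apply/asboolP/box_representable_card. Qed.

Definition boxicity (R : realType) (G : sgraph) : nat :=
  ex_minn (box_representable_ex R G).

Definition kneser_vertex (k n : nat) : finType :=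
  {A : {set 'I_n} | #|A| == k}.

(* The condition A != B only matters for k = 0; for k > 0 a k-set is never
   disjoint from itself. *)
Definition kneser_edge (k n : nat) : rel (kneser_vertex k n) :=
  fun A B => (A != B) && [disjoint val A & val B].

Lemma kneser_edge_sym (k n : nat) : symmetric (@kneser_edge k n).
Proof. by move=> A B; rewrite /kneser_edge eq_sym disjoint_sym. Qed.

Lemma kneser_edge_irr (k n : nat) : irreflexive (@kneser_edge k n).
Proof. by move=> A; rewrite /kneser_edge eqxx. Qed.

Definition kneser (k n : nat) : sgraph :=
  SGraph (@kneser_edge_sym k n) (@kneser_edge_irr k n).

(* Main.v *)
(* Write c = C(n-1, k-1) and u = C(n-2, k-2) for the numbers of k-sets through one
   and through two given points.

   Lower bound: in a coordinate, put A before B when the interval of A lies entirely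
   to the left of the interval of B.  The k-sets comparable in some coordinate are
   exactly the meeting ones, so the coordinates must cover all meeting pairs, of
   which there are about n c^2 / 2.  Enumerate the k-sets as a_0, a_1, ... by
   decreasing number of successors and as b_0, b_1, ... by decreasing number of
   predecessors: the relation becomes a staircase, and when a_j is before b_i the
   families {a_0, ..., a_j} and {b_0, ..., b_i} are disjoint and every member of the
   first meets every member of the second.  If both have more than k u members,
   they lie in a common star (here 2 k^2 u <= c is used, which is what
   n >= 2k^3 - 2k^2 + 1 gives), so j + i + 2 <= c.  Row j of the staircase has at
   most k c entries, and at most c + k^2 u entries when j >= u.  Hence a coordinate
   covers at most c^2 / 2 + (3k - 2) u c pairs, and the bound follows by counting.

   Upper bound: one coordinate for each point i other than two fixed points a and b;
   it separates all pairs of sets containing i, and also separates sets containing i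
   from sets avoiding i when they share a or b. *)

Require Import Defs.
From HB Require Import structures.
From mathcomp Require Import all_boot all_order all_algebra.
From mathcomp Require Import all_classical all_reals all_analysis.
From mathcomp Require Import zify ring lra finset.
Import numFieldNormedType.Exports.
Import Order.TTheory GRing.Theory Num.Theory.

Set Implicit Arguments.
Unset Strict Implicit.
Unset Printing Implicit Defensive.

(** * Cross-meeting families of [k]-sets *)

Definition kfamily (T : finType) (k : nat) (F : {set {set T}}) : Prop :=
  forall A, A \in F -> #|A| = k.

Definition cross_meeting (T : finType) (F G : {set {set T}}) : Prop :=
  forall A B, A \in F -> B \in G -> ~~ [disjoint A & B].

Definition core (T : finType) (F : {set {set T}}) : {set T} :=
  [set x | [forall A in F, x \in A]].

Lemma coreP (T : finType) (F : {set {set T}}) (x : T) :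
  reflect (forall A, A \in F -> x \in A) (x \in core F).
Proof.
rewrite inE; apply: (iffP forallP) => [h A|h A]; first exact: (implyP (h A)).
by apply/implyP/h.
Qed.

Lemma card_supersets (T : finType) (X : {set T}) (k : nat) :
  #|X| <= k ->
  #|[set A : {set T} | X \subset A & #|A| == k]| = 'C(#|T| - #|X|, k - #|X|).
Proof.
move=> Xk; have cX : #|setC X| = #|T| - #|X| by rewrite [LHS]cardsCs setCK.
rewrite -cX -cards_draws -[RHS](@card_in_imset _ _ (fun B => X :|: B)); last first.
  move=> B B'; rewrite !inE => /andP[BX _] /andP[B'X _] /(congr1 (fun C => C :\: X)).
  rewrite !setDUl !setDv.
  by move: BX B'X; rewrite -!disjoints_subset => /setDidPl-> /setDidPl->; rewrite !set0U.
apply: eq_card => A; rewrite !inE; apply/idP/imsetP => [/andP[XA /eqP cA]|[B]].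
  exists (A :\: X); last first.
    by apply/setP => z; rewrite !inE; case: (boolP (z \in X)) => //= /(fintype.subsetP XA).
  by rewrite inE setDE subsetIr -setDE cardsDS // cA eqxx.
rewrite inE => /andP[BX /eqP cB] ->; rewrite subsetUl cardsU cB.
have XB : [disjoint X & B] by rewrite disjoint_sym disjoints_subset.
by rewrite disjoint_setI0 // cards0 subn0 subnKC /=.
Qed.

Lemma card_star_le (T : finType) (k : nat) (F : {set {set T}}) (x : T) :
  kfamily k F -> (forall A, A \in F -> x \in A) -> #|F| <= 'C(#|T|.-1, k.-1).
Proof.
move=> kF xF; have [->|[A AF]] := set_0Vmem F; first by rewrite cards0.
have k1 : #|[set x]| <= k.
  by rewrite -(kF _ AF) subset_leq_card // sub1set xF.
have := card_supersets k1; rewrite cards1 !subn1 => <-.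
apply/subset_leq_card/fintype.subsetP => B BF.
by rewrite inE sub1set xF // kF ?eqxx.
Qed.

Lemma card_star2_le (T : finType) (k : nat) (F : {set {set T}}) (x y : T) :
  x != y -> kfamily k F -> (forall A, A \in F -> x \in A) ->
  (forall A, A \in F -> y \in A) -> #|F| <= 'C(#|T|.-2, k.-2).
Proof.
move=> xy kF xF yF; have [->|[A AF]] := set_0Vmem F; first by rewrite cards0.
have sub B : B \in F -> [set x; y] \subset B.
  by move=> BF; apply/fintype.subsetP => z; rewrite !inE => /orP[]/eqP->; auto.
have c2 : #|[set x; y]| = 2 by rewrite cards2 xy.
have k2 : #|[set x; y]| <= k by rewrite -(kF _ AF) subset_leq_card // sub.
have := card_supersets k2; rewrite c2 !subn2 => <-.
apply/subset_leq_card/fintype.subsetP => B BF.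
by rewrite inE sub // kF ?eqxx.
Qed.

Lemma card_meeting_le (T : finType) (A : {set T}) (G : {set {set T}}) :
  (forall B, B \in G -> ~~ [disjoint A & B]) ->
  #|G| <= \sum_(z in A) #|[set B in G | z \in B]|.
Proof.
move=> meet; rewrite -sum1_card.
rewrite (eq_bigr (fun z => \sum_(B in G) (z \in B))); last first.
  move=> z _; rewrite -sum1_card -big_mkcondr.
  by apply: eq_bigl => B; rewrite inE.
rewrite exchange_big /=; apply: leq_sum => B BG.
have /pred0Pn[z /andP[zA zB]] := meet _ BG.
by rewrite (bigD1 z) //= (zB : z \in B).
Qed.

(** Each member of [G] contains [y] and some [z] in [A], and [z != y] because [y] is not in [A];
    this gives [k] families through two points. *)
Lemma card_meeting_star_le (T : finType) (k : nat) (A : {set T})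
    (G : {set {set T}}) (y : T) :
  #|A| = k -> kfamily k G -> y \notin A ->
  (forall B, B \in G -> ~~ [disjoint A & B]) ->
  (forall B, B \in G -> y \in B) -> #|G| <= k * 'C(#|T|.-2, k.-2).
Proof.
move=> cA kG yA /card_meeting_le meet yG; apply: leq_trans meet _.
rewrite -cA -sum_nat_const cA; apply: leq_sum => z zA.
apply: (@card_star2_le _ _ _ y z).
- by apply: contraNneq yA => ->.
- by move=> B; rewrite inE => /andP[/kG].
- by move=> B; rewrite inE => /andP[/yG].
- by move=> B; rewrite inE => /andP[].
Qed.

Lemma card_meeting_set_le (T : finType) (k : nat) (A : {set T})
    (G : {set {set T}}) :
  #|A| = k -> kfamily k G -> (forall B, B \in G -> ~~ [disjoint A & B]) ->
  #|G| <= k * 'C(#|T|.-1, k.-1).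
Proof.
move=> cA kG /card_meeting_le meet; apply: leq_trans meet _.
rewrite -[k in k * _]cA -sum_nat_const; apply: leq_sum => z zA.
apply: (@card_star_le _ _ _ z) => B; rewrite inE => /andP[] //.
by move=> /kG.
Qed.

(** Fix [A] in [F] and sort the members of [G] by a point [z] of [A] that they contain. A core point
    accounts for at most a full star. If [z] is not in the core, some [A'] in [F] avoids it, and the
    members of [G] through [z] must still meet [A']. *)
Lemma card_cross_core_le (T : finType) (k : nat) (F G : {set {set T}}) :
  F != set0 -> kfamily k F -> kfamily k G -> cross_meeting F G ->
  #|G| <= #|core F| * 'C(#|T|.-1, k.-1) + k * (k * 'C(#|T|.-2, k.-2)).
Proof.
move=> /set0Pn[A AF] kF kG cross.
apply: leq_trans (card_meeting_le (fun B => cross A B AF)) _.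
set c := 'C(_, _); set u := 'C(_, _).
apply: (@leq_trans (\sum_(z in A) ((z \in core F) * c + k * u))); last first.
  rewrite big_split /= sum_nat_const kF // leq_add2r -big_distrl /=.
  rewrite leq_mul2r -sum1_card [leqRHS]big_mkcond [leqLHS]big_mkcond /=.
  apply/orP; right; apply: leq_sum => z _.
  by case: (z \in A); case: (z \in core F).
apply: leq_sum => z zA; have kGz : kfamily k [set B in G | z \in B].
  by move=> B; rewrite inE => /andP[/kG].
case: (boolP (z \in core F)) => [_|zF].
  rewrite mul1n (leq_trans _ (leq_addr _ _)) //; apply: (card_star_le (x := z) kGz).
  by move=> B; rewrite inE => /andP[].
have [A' A'F zA'] : exists2 A', A' \in F & z \notin A'.
  move: zF; rewrite inE negb_forall => /existsP[A']; rewrite negb_imply.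
  by move=> /andP[? ?]; exists A'.
rewrite add0n; apply: (card_meeting_star_le (y := z) (kF _ A'F) kGz zA').
  by move=> B; rewrite inE => /andP[BG _]; exact: cross.
by move=> B; rewrite inE => /andP[].
Qed.

Lemma card_core_le1 (T : finType) (k : nat) (F : {set {set T}}) :
  kfamily k F -> 'C(#|T|.-2, k.-2) < #|F| -> #|core F| <= 1.
Proof.
move=> kF; apply: contraTT; rewrite -ltnNge -leqNgt => /card_gt1P[x [y [xF yF xy]]].
by apply: (card_star2_le xy kF) => A; [move/coreP: xF; apply|move/coreP: yF; apply].
Qed.

(* If one family is too large for the other to have an empty core, then the
   other one lies in a star, and so does the first. *)
Lemma card_cross_meeting (T : finType) (k : nat) (F G : {set {set T}}) :
  kfamily k F -> kfamily k G -> [disjoint F & G] -> cross_meeting F G ->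
  2 * (k * (k * 'C(#|T|.-2, k.-2))) <= 'C(#|T|.-1, k.-1) ->
  k * 'C(#|T|.-2, k.-2) < #|F| -> k * 'C(#|T|.-2, k.-2) < #|G| ->
  #|F| + #|G| <= 'C(#|T|.-1, k.-1).
Proof.
set c := 'C(_, k.-1); set u := 'C(_, _) => kF kG FG0 FG hc uF uG.
(* With an empty core of [F1], [G1] would be too small. For [x] in that core, a member of [G1]
   avoiding [x] would make [F1] too small, so both families lie in the star of [x]. *)
have star (F1 G1 : {set {set T}}) : kfamily k F1 -> kfamily k G1 -> [disjoint F1 & G1] ->
  cross_meeting F1 G1 -> k * u < #|F1| -> k * (k * u) < #|G1| -> #|F1| + #|G1| <= c.
  move=> kF1 kG1 dFG crossFG uF1 uG1.
  have F1n0 : F1 != set0 by rewrite -card_gt0 (leq_trans _ uF1).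
  have [F1core|[x xF1]] := set_0Vmem (core F1).
    have := card_cross_core_le F1n0 kF1 kG1 crossFG.
    by rewrite F1core cards0 mul0n leqNgt uG1.
  have /coreP xG1 : x \in core G1.
    apply: contraLR uF1; rewrite inE negb_forall => /existsP[B].
    rewrite negb_imply => /andP[BG1 xB]; rewrite -leqNgt.
    apply: (card_meeting_star_le (kG1 _ BG1) kF1 xB) => A AF1; last exact/coreP/AF1.
    by rewrite disjoint_sym crossFG.
  have <- : #|F1 :|: G1| = #|F1| + #|G1| by rewrite cardsU disjoint_setI0 // cards0 subn0.
  apply: (@card_star_le _ _ _ x) => A; rewrite inE => /orP[]; auto.
  by move=> AF; move/coreP: xF1; apply.
have [uuG|] := ltnP (k * (k * u)) #|G|; first exact: star.
have [uuF _|uuF uuG] := ltnP (k * (k * u)) #|F|.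
  rewrite addnC; apply: star => //; first by rewrite disjoint_sym.
  by move=> A B AG BF; rewrite disjoint_sym FG.
by apply: leq_trans (leq_add uuF uuG) _; rewrite addnn -mul2n.
Qed.

(** * Staircases *)

Lemma sum_shift (f : nat -> nat) (g N : nat) :
  \sum_(j < N) (g <= j) * f (j - g) = \sum_(j < N - g) f j.
Proof.
elim: N => [|N IH]; first by rewrite !big_ord0.
rewrite big_ord_recr /= IH; case: leqP => gN; first by rewrite subSn // big_ord_recr mul1n.
have /eqP-> : N.+1 - g == 0 by rewrite subn_eq0.
by have /eqP-> : N - g == 0 by [rewrite subn_eq0 ltnW]; rewrite !big_ord0.
Qed.

Lemma sum_ltn_minn (a N : nat) : \sum_(i < N) (i < a) = minn N a.
Proof.
elim: N => [|N IH]; first by rewrite big_ord0 min0n.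
by rewrite big_ord_recr /= IH; lia.
Qed.

Lemma sum_subn_le (m N : nat) : 2 * \sum_(j < N) (m - j.+1) <= m ^ 2.
Proof.
elim: m N => [|m IH] [|N]; rewrite ?big_ord0 ?muln0 // big_ord_recl /=.
  by rewrite big1 // => i _; rewrite sub0n.
rewrite (eq_bigr (fun j : 'I_N => m - j.+1)) => [|j _]; last by rewrite /bump; lia.
by rewrite subSS subn0 mulnDr -(addn1 m) sqrnD addnC muln1 leq_add // (leq_trans (IH N)) ?leq_addr.
Qed.

(* The part of the lower triangle [j + i + 2 <= c] outside of the first [g] rows
   and columns is a triangle of side [c - 2 * g]. *)
Lemma staircase_area_le (P : nat -> nat -> bool) (N g c : nat) :
  (forall j i, j < N -> i < N -> P j i -> g <= j -> g <= i -> j + i + 2 <= c) ->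
  2 * \sum_(j < N) \sum_(i < N) P j i <=
  2 * (\sum_(j < N) (j < g) * \sum_(i < N) P j i +
       \sum_(i < N) (i < g) * \sum_(j < N) P j i) + (c - 2 * g) ^ 2.
Proof.
move=> Pc; pose m := c - 2 * g.
apply: (@leq_trans (2 * (\sum_(j < N) (j < g) * \sum_(i < N) P j i +
  \sum_(i < N) (i < g) * \sum_(j < N) P j i +
  \sum_(j < N) (g <= j) * (m - (j - g).+1)))); last first.
  by rewrite mulnDr leq_add2l (sum_shift (fun j => m - j.+1)) sum_subn_le.
rewrite leq_mul2l /=.
under [X in _ <= _ + X + _]eq_bigr => i _ do rewrite big_distrr /=.
rewrite [X in _ <= _ + X + _]exchange_big /= -!big_split /=.
apply: leq_sum => j _.
case: (ltnP j g) => jg /=; first by rewrite mul1n -addnA leq_addr.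
rewrite mul0n add0n mul1n.
(* Shifting both indices by [g] turns [j + i + 2 <= c] into [i - g < m - (j - g).+1]. *)
apply: (@leq_trans (\sum_(i < N) ((i < g) * P j i + (g <= i) * (i - g < m - (j - g).+1)))).
  apply: leq_sum => i _; case: (ltnP i g) => ig /=; first by rewrite mul1n addn0.
  rewrite mul0n mul1n add0n; case: (boolP (P j i)) => // Pji.
  by have := Pc j i (ltn_ord j) (ltn_ord i) Pji jg ig; rewrite /m; lia.
rewrite big_split /= leq_add2l (sum_shift (fun i => nat_of_bool (i < m - (j - g).+1))).
by rewrite sum_ltn_minn geq_minr.
Qed.

(** Equivalently, the successor sets form a chain under inclusion; with irreflexivity added, these
    are the interval orders. *)
Definition ferrers (V : finType) (p : rel V) : Prop :=
  forall A B A' B', p A B -> p A' B' -> p A B' || p A' B.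

Lemma ferrers_enum (V : finType) (p : rel V) : ferrers p ->
  exists s : seq V, perm_eq s (enum V) /\
    forall x0 i j y, i <= j < #|V| -> p (nth x0 s j) y -> p (nth x0 s i) y.
Proof.
move=> pF; pose le A B := #|[set y | p B y]| <= #|[set y | p A y]|.
have le_tot : total le by move=> A B; rewrite /le leq_total.
have le_trans : transitive le by move=> A B C /[swap]; rewrite /le; exact: leq_trans.
exists (sort le (enum V)); split; first by rewrite perm_sort.
move=> x0 i j y /andP[ij jV].
have szs : size (sort le (enum V)) = #|V| by rewrite size_sort cardE.
have := @sorted_leq_nth _ _ le_trans _ x0 _ (sort_sorted le_tot (enum V)) i j.
rewrite !inE szs jV (leq_ltn_trans ij jV) => /(_ _ isT isT ij) le_ij.
move: (le_ij (fun _ => leqnn _)); rewrite /le; move: (nth _ _ i) (nth _ _ j) => A B.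
(* If [y] were a successor of [B] but not of [A], the successors of [A] would form a proper subset
   of those of [B]. *)
move=> leAB pBy; apply: contraLR leAB => pAy; rewrite -ltnNge.
apply/proper_card/properP; split; last by exists y; rewrite inE.
apply/fintype.subsetP => z; rewrite !inE => pAz.
by have := pF _ _ _ _ pAz pBy; rewrite (negbTE pAy).
Qed.

Definition kmeeting (T : finType) (k : nat) (p : rel {set T}) : Prop :=
  forall A B, p A B -> [/\ #|A| = k, #|B| = k, A != B & ~~ [disjoint A & B]].

Lemma card_seq_prefix (V : finType) (s : seq V) (j : nat) :
  uniq s -> j < size s -> #|[set x in take j.+1 s]| = j.+1.
Proof.
move=> us js; rewrite cardsE; have /card_uniqP-> := take_uniq j.+1 us.
by rewrite size_takel.
Qed.

(** The first [j + 1] sets share all successors of the [j]-th, hence cross-meet them. Once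
    [j >= 'C(#|T|.-2, k.-2)], they are too many to have two core points. Earlier rows only use that
    each successor meets the [j]-th set. *)
Lemma ferrers_row_le (T : finType) (k : nat) (p : rel {set T}) (s : seq {set T}) (j : nat) :
  kmeeting k p -> perm_eq s (enum {set T}) ->
  (forall i j y, i <= j < #|{set T}| -> p (nth set0 s j) y -> p (nth set0 s i) y) ->
  j < #|{set T}| ->
  \sum_(B : {set T}) p (nth set0 s j) B <=
  if j < 'C(#|T|.-2, k.-2) then k * 'C(#|T|.-1, k.-1)
  else 'C(#|T|.-1, k.-1) + k * (k * 'C(#|T|.-2, k.-2)).
Proof.
move=> pk ps down jN; set a := nth _ s.
have -> : \sum_(B : {set T}) p (a j) B = #|[set B | p (a j) B]|.
  by rewrite -sum1dep_card [RHS]big_mkcond.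
set U := [set B | _].
have [->|[B0 B0U]] := set_0Vmem U; first by rewrite cards0.
have kU : kfamily k U by move=> B; rewrite inE => /pk[].
case: ltnP => ju.
  apply: (card_meeting_set_le (A := a j)) => //.
    by move: B0U; rewrite inE => /pk[].
  by move=> B; rewrite inE => /pk[].
have szs : size s = #|{set T}| by rewrite (perm_size ps) cardE.
pose F := [set A in take j.+1 s].
have cF : #|F| = j.+1.
  by apply: card_seq_prefix; rewrite ?szs // (perm_uniq ps) enum_uniq.
have pFU A B : A \in F -> B \in U -> p A B.
  rewrite !inE => /(nthP set0)[i]; rewrite size_takel ?szs // => ij <-.
  by rewrite nth_take //; apply: down; rewrite -ltnS ij.
have kF : kfamily k F by move=> A AF; have /pk[] := pFU _ _ AF B0U.
have F0 : F != set0 by rewrite -card_gt0 cF.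
have crossFU : cross_meeting F U by move=> A B AF BU; have /pk[] := pFU _ _ AF BU.
apply: leq_trans (card_cross_core_le F0 kF kU crossFU) _.
rewrite leq_add2r -[leqRHS]mul1n leq_mul2r (@card_core_le1 _ k) ?orbT //.
by rewrite cF ltnS.
Qed.

Lemma ferrers_row_sum_le (T : finType) (k : nat) (p : rel {set T}) (s : seq {set T}) :
  let c := 'C(#|T|.-1, k.-1) in let u := 'C(#|T|.-2, k.-2) in
  kmeeting k p -> perm_eq s (enum {set T}) ->
  (forall i j y, i <= j < #|{set T}| -> p (nth set0 s j) y -> p (nth set0 s i) y) ->
  0 < k ->
  \sum_(j < #|{set T}|) (j < k * u) * \sum_(B : {set T}) p (nth set0 s j) B <=
  u * (k * c) + (k * u - u) * (c + k * (k * u)).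
Proof.
move=> c u pk ps down k0.
apply: (@leq_trans (\sum_(j < #|{set T}|)
  ((j < u) * (k * c) + (u <= j) * (j - u < k * u - u) * (c + k * (k * u))))).
  apply: leq_sum => j _; case: (ltnP j (k * u)) => // jku; rewrite mul1n.
  apply: leq_trans (ferrers_row_le pk ps down (ltn_ord j)) _; rewrite -/u -/c.
  case: ltnP => uj; first by rewrite mul1n leq_addr.
  by rewrite ltn_sub2r ?(leq_ltn_trans uj) // !mul1n leq_addl.
rewrite big_split /= -!big_distrl /= sum_ltn_minn.
rewrite (sum_shift (fun j => nat_of_bool (j < k * u - u))) sum_ltn_minn.
by rewrite leq_add // leq_mul // geq_minr.
Qed.

(** As [k^2 u <= c / 2], each of [y], [z] is at most [(k + 3 (k - 1) / 2) u c], so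
    [2 (y + z) <= (10 k - 6) u c]; the square is at most [c^2 - (4 k - 2) u c]. The sum is
    [c^2 + (6 k - 4) u c], written without subtraction. *)
Lemma staircase_bound (k c u x y z : nat) :
  0 < k -> 2 * (k * (k * u)) <= c ->
  2 * x <= 2 * (y + z) + (c - 2 * (k * u)) ^ 2 ->
  y <= u * (k * c) + (k * u - u) * (c + k * (k * u)) ->
  z <= u * (k * c) + (k * u - u) * (c + k * (k * u)) ->
  2 * x + 4 * (u * c) <= c ^ 2 + 6 * k * (u * c).
Proof.
move=> k0 hc.
have /subnK : 2 * (k * u) <= c by apply: leq_trans hc; rewrite leq_mul2l leq_pmull.
move: (c - _) => m mE.
have m2 : m ^ 2 + 4 * (k * u * c) = c ^ 2 + 4 * (k * u * (k * u)).
  by rewrite -mE; ring.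
have hu : u * (2 * (k * (k * u))) <= u * c by rewrite leq_mul2l hc orbT.
have hv : (k * u - u) * (2 * (k * (k * u))) <= (k * u - u) * c by rewrite leq_mul2l hc orbT.
case: k k0 {hc mE} m2 hu hv => // k _.
rewrite !(mulSn k u) addKn => m2 hu hv xyz yB zB; nia.
Qed.

Lemma ferrers_area_le (T : finType) (k : nat) (p : rel {set T}) :
  let c := 'C(#|T|.-1, k.-1) in let u := 'C(#|T|.-2, k.-2) in
  1 < k -> 2 * (k * (k * u)) <= c -> ferrers p -> kmeeting k p ->
  2 * \sum_(A : {set T}) \sum_(B : {set T}) p A B + 4 * (u * c) <=
  c ^ 2 + 6 * k * (u * c).
Proof.
(* The columns of [p] are the rows of its converse [q], which satisfies the same hypotheses. *)
move=> c u k1 hc pF pk; pose q := fun B A => p A B.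
have qF : ferrers q by move=> A B A' B' h1 h2; have := pF _ _ _ _ h1 h2; rewrite orbC.
have qk : kmeeting k q.
  by move=> A B /pk[? ? ? ?]; rewrite eq_sym disjoint_sym.
have [s [ps /(_ set0) sdown]] := ferrers_enum pF.
have [t [pt /(_ set0) tdown]] := ferrers_enum qF.
have szs : size s = #|{set T}| by rewrite (perm_size ps) cardE.
have szt : size t = #|{set T}| by rewrite (perm_size pt) cardE.
pose N := #|{set T}|; pose P j i := p (nth set0 s j) (nth set0 t i).
have sumE (r : seq {set T}) (f : {set T} -> nat) : perm_eq r (enum {set T}) ->
    \sum_(A : {set T}) f A = \sum_(j < N) f (nth set0 r j).
  move=> pr; rewrite -big_enum -(perm_big _ pr) /= (big_nth set0) big_mkord.
  by rewrite (perm_size pr) -cardE.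
have rowE j : \sum_(B : {set T}) p (nth set0 s j) B = \sum_(i < N) P j i.
  exact: sumE.
have colE i : \sum_(A : {set T}) q (nth set0 t i) A = \sum_(j < N) P j i.
  exact: sumE.
(* A filled cell fills everything above and to the left of it; the prefixes have [j + 1] and [i + 1]
   members. *)
have corner j i : j < N -> i < N -> P j i -> k * u <= j -> k * u <= i -> j + i + 2 <= c.
  move=> jN iN Pji uj ui.
  pose F := [set A in take j.+1 s]; pose G := [set A in take i.+1 t].
  have cF : #|F| = j.+1.
    by apply: card_seq_prefix; rewrite ?szs // (perm_uniq ps) enum_uniq.
  have cG : #|G| = i.+1.
    by apply: card_seq_prefix; rewrite ?szt // (perm_uniq pt) enum_uniq.
  have pFG A B : A \in F -> B \in G -> p A B.
    rewrite !inE => /(nthP set0)[j']; rewrite size_takel ?szs // => j'j <-.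
    move=> /(nthP set0)[i']; rewrite size_takel ?szt // => i'i <-.
    rewrite !nth_take //; apply: (sdown j' j); first by rewrite -ltnS j'j.
    by apply: (tdown i' i) => //; rewrite -ltnS i'i.
  have [A0 A0F] : exists A0, A0 \in F by apply/set0Pn; rewrite -card_gt0 cF.
  have [B0 B0G] : exists B0, B0 \in G by apply/set0Pn; rewrite -card_gt0 cG.
  have -> : j + i + 2 = #|F| + #|G| by rewrite cF cG; lia.
  apply: card_cross_meeting; rewrite ?cF ?cG ?ltnS //.
  - by move=> A AF; have /pk[] := pFG _ _ AF B0G.
  - by move=> B BG; have /pk[] := pFG _ _ A0F BG.
  - apply/pred0P => A /=; apply/negP => /andP[AF AG].
    by have /pk[_ _] := pFG _ _ AF AG; rewrite eqxx.
  - by move=> A B AF BG; have /pk[] := pFG _ _ AF BG.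
have := staircase_area_le corner.
have -> : \sum_(A : {set T}) \sum_(B : {set T}) p A B = \sum_(j < N) \sum_(i < N) P j i.
  by rewrite (sumE s) //; apply: eq_bigr => j _; exact: rowE.
have : \sum_(j < N) (j < k * u) * \sum_(i < N) P j i <=
    u * (k * c) + (k * u - u) * (c + k * (k * u)).
  by under eq_bigr do rewrite -rowE; apply: ferrers_row_sum_le => //; exact: ltnW.
have : \sum_(i < N) (i < k * u) * \sum_(j < N) P j i <=
    u * (k * c) + (k * u - u) * (c + k * (k * u)).
  by under eq_bigr do rewrite -colE; apply: (ferrers_row_sum_le qk) => //; exact: ltnW.
by move=> yB zB xyz; apply: staircase_bound hc xyz zB yB; exact: ltnW.
Qed.

(** * Counting meeting pairs *)

(** With [f] the indicator of containing a point, or a pair of points, this evaluates the first two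
    moments of [#|A :&: B|]. *)
Lemma sum_prod_square (I V : finType) (Q : pred I) (D : pred V) (f : I -> V -> nat) :
  \sum_(A | D A) \sum_(B | D B) \sum_(i | Q i) f i A * f i B =
  \sum_(i | Q i) (\sum_(A | D A) f i A) ^ 2.
Proof.
under eq_bigr do rewrite exchange_big /=.
rewrite exchange_big /=; apply: eq_bigr => i _.
by rewrite -mulnn big_distrl /=; apply: eq_bigr => A _; rewrite big_distrr.
Qed.

Lemma sum_pairs_in (T : finType) (A : {set T}) :
  \sum_(z : T * T | z.1 != z.2) ((z.1 \in A) && (z.2 \in A)) = #|A| * #|A|.-1.
Proof.
rewrite -(pair_big_dep xpredT (fun x y => x != y)
  (fun x y => nat_of_bool ((x \in A) && (y \in A)))) /=.
rewrite -sum_nat_const big_mkcond [RHS]big_mkcond /=; apply: eq_bigr => x _.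
case: ifP => xA; last by rewrite big1.
rewrite (cardsD1 x A) xA add1n -sum1_card big_mkcond [RHS]big_mkcond /=.
by apply: eq_bigr => y _; rewrite !inE eq_sym; case: eqP; case: (y \in A).
Qed.

Lemma sum_star (T : finType) (k : nat) (x : T) : 0 < k ->
  \sum_(A : {set T} | #|A| == k) (x \in A) = 'C(#|T|.-1, k.-1).
Proof.
move=> k0; have := @card_supersets T [set x] k; rewrite cards1 !subn1 => <- //.
rewrite -sum1dep_card -big_mkcondr; apply: eq_bigl => A.
by rewrite sub1set andbC.
Qed.

Lemma sum_star2 (T : finType) (k : nat) (x y : T) : 1 < k -> x != y ->
  \sum_(A : {set T} | #|A| == k) ((x \in A) && (y \in A)) = 'C(#|T|.-2, k.-2).
Proof.
move=> k1 xy; have := @card_supersets T [set x; y] k; rewrite cards2 xy !subn2 => <- //.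
rewrite -sum1dep_card -big_mkcondr; apply: eq_bigl => A.
by rewrite subUset !sub1set andbC.
Qed.

(* Bonferroni: [m <= 1 + m * (m - 1) / 2] for the size [m] of an intersection. *)
Lemma meeting_pairs_ge (T : finType) (k : nat) :
  let c := 'C(#|T|.-1, k.-1) in let u := 'C(#|T|.-2, k.-2) in
  1 < k ->
  2 * (#|T| * c ^ 2) <=
  2 * (\sum_(A : {set T} | #|A| == k) \sum_(B : {set T} | #|B| == k)
         ((A != B) && ~~ [disjoint A & B])) +
  2 * (#|T| * c) + #|T| * #|T|.-1 * u ^ 2.
Proof.
move=> c u k1; have k0 := ltnW k1; pose D := fun A : {set T} => #|A| == k.
have cardE (A : {set T}) : #|A| = \sum_x (x \in A).
  by rewrite -sum1_card big_mkcond.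
have -> : #|T| * c ^ 2 = \sum_(A | D A) \sum_(B | D B) #|A :&: B|.
  rewrite -sum_nat_const -(eq_bigr _ (fun x _ => congr1 (expn^~ 2) (sum_star x k0))).
  rewrite -(sum_prod_square _ D (fun x (A : {set T}) => nat_of_bool (x \in A))).
  apply: eq_bigr => A _; apply: eq_bigr => B _; rewrite cardE.
  by apply: eq_bigr => x _; rewrite inE mulnb.
(* Pairs with [A = B] do not count as meeting pairs; this term pays for their [#|A :&: B|]. *)
have -> : #|T| * c = \sum_(A | D A) \sum_(B | D B) (A == B) * #|A|.
  rewrite -sum_nat_const -(eq_bigr _ (fun x _ => sum_star x k0)) exchange_big /=.
  apply: eq_bigr => A DA; rewrite -cardE (bigD1 A) //= eqxx mul1n big1 ?addn0 // => B.
  by rewrite eq_sym => /andP[_ /negPf->].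
have -> : #|T| * #|T|.-1 * u ^ 2 =
    \sum_(A | D A) \sum_(B | D B) #|A :&: B| * #|A :&: B|.-1.
  have -> : #|T| * #|T|.-1 = \sum_(z : T * T | z.1 != z.2) 1.
    rewrite -cardsT -sum_pairs_in; apply: eq_bigr => z _; by rewrite !inE.
  rewrite big_distrl /=.
  rewrite (eq_bigr (fun z => (\sum_(A : {set T} | D A) ((z.1 \in A) && (z.2 \in A))) ^ 2)).
    rewrite -(sum_prod_square (fun z : T * T => z.1 != z.2) D
       (fun z (A : {set T}) => nat_of_bool ((z.1 \in A) && (z.2 \in A)))).
    apply: eq_bigr => A _; apply: eq_bigr => B _; rewrite -sum_pairs_in.
    by apply: eq_bigr => z _; rewrite !inE mulnb; do !case: (_ \in _).
  by move=> z xy; rewrite mul1n sum_star2.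
rewrite !big_distrr -!big_split /=; apply: leq_sum => A _.
rewrite !big_distrr -!big_split /=; apply: leq_sum => B _.
have [<-|AB] /= := eqVneq A B; first by rewrite setIid muln0 mul1n add0n leq_addr.
rewrite mul0n muln0 addn0 -setI_eq0 -cards_eq0; case: #|A :&: B| => // -[|m] //=.
by rewrite muln1 mulSn mulnS; lia.
Qed.

(** Here [t] is the number of ordered meeting pairs, bounded below by counting and above by the
    capacity of [d] coordinates. After division by [c], the relation [(n - 1) u = (k - 1) c] gives
    [d u <= u + (k - 1) c]. The coefficient 13 is 12 from [12 k d u] plus 1 from [n (k - 1) u]. *)
Lemma cover_bound_arith (n k d c u t : nat) :
  1 < k -> d <= n -> 0 < u -> n.-1 * u = k.-1 * c -> 2 * (k * (k * u)) <= c ->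
  2 * (n * c ^ 2) <= 2 * t + 2 * (n * c) + n * n.-1 * u ^ 2 ->
  t + d * (4 * (u * c)) <= d * (c ^ 2 + 6 * k * (u * c)) ->
  2 * n + 11 * k <= 2 * d + 13 * k ^ 2 + 16.
Proof.
move=> k1 dn u0 nu hc count area.
have c0 : 0 < c by apply: leq_trans hc; rewrite !muln_gt0 u0 (ltnW k1).
have n0 : 0 < n by case: n nu {dn count} => //= /eqP; rewrite mul0n eq_sym muln_eq0; lia.
have {}count : 2 * (n * c) + 8 * (d * u) <= 2 * (d * c) + 12 * (k * (d * u)) + 2 * n + n * (k.-1 * u).
  have nu2 : n * n.-1 * u ^ 2 = n * (k.-1 * u) * c.
    by rewrite -mulnn -mulnA [n.-1 * _]mulnA nu; ring.
  by rewrite -(leq_pmul2r c0); rewrite nu2 in count; nia.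
case: k k1 nu hc count {area} => [|[|k]] //= _ nu hc count.
case: n n0 dn nu count => //= n _ dn nu count.
have du : d * u <= u + k.+1 * c by rewrite -nu -mulSn leq_mul2r dn orbT.
have nc : n <= k.+1 * c by rewrite -nu leq_pmulr.
have cu : 8 * (k * u) + 8 * u + 2 * (k * (k * u))<= c by nia.
rewrite -(leq_pmul2r c0).
nia.
Qed.

Lemma ferrers_cover_bound (T : finType) (k d : nat) (p : 'I_d -> rel {set T}) :
  1 < k -> 2 * k ^ 3 - 2 * k ^ 2 + 1 <= #|T| -> d <= #|T| ->
  (forall i, ferrers (p i)) -> (forall i, kmeeting k (p i)) ->
  (forall A B : {set T}, #|A| = k -> #|B| = k -> A != B -> ~~ [disjoint A & B] ->
    exists i, p i A B || p i B A) ->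
  2 * #|T| + 11 * k <= 2 * d + 13 * k ^ 2 + 16.
Proof.
move=> k1 nk dn pF pk cover.
have [u u0 hu] : exists2 u, 0 < u & u = 'C(#|T|.-2, k.-2).
  by exists 'C(#|T|.-2, k.-2) => //; rewrite bin_gt0; nia.
have nu : #|T|.-1 * 'C(#|T|.-2, k.-2) = k.-1 * 'C(#|T|.-1, k.-1).
  by case: k k1 {nk pk cover hu} => [|[|k]] //= _; rewrite mul_bin_diag.
have hc : 2 * (k * (k * 'C(#|T|.-2, k.-2))) <= 'C(#|T|.-1, k.-1).
  have k10 : 0 < k.-1 by case: k k1 {nk pk cover hu nu} => [|[]].
  (* Multiplied by [k - 1], the claim becomes [2 k^2 (k - 1) <= n - 1] with [n = #|T|], which is the
     hypothesis on [#|T|]. *)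
  rewrite -(leq_pmul2l k10) -nu !mulnA leq_mul2r; apply/orP; right.
  by case: k k1 nk {k10 pk cover hu nu} => [|k] //= _; nia.
apply: (cover_bound_arith k1 dn _ nu hc (meeting_pairs_ge T k1)); first by rewrite -hu.
rewrite -[X in _ <= X * _]card_ord -sum_nat_const.
apply: (@leq_trans (\sum_(i < d) (2 * \sum_(A : {set T}) \sum_(B : {set T}) p i A B +
  4 * ('C(#|T|.-2, k.-2) * 'C(#|T|.-1, k.-1))))); last first.
  by apply: leq_sum => i _; exact: ferrers_area_le.
rewrite big_split /= sum_nat_const card_ord leq_add2r.
rewrite -big_distrr /= [in leqRHS]exchange_big /=.
under [in leqRHS]eq_bigr do rewrite exchange_big /=.
(* One copy of the sum is transposed, so that an ordered pair is paid for by either orientation of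
   [p i]. *)
rewrite mul2n -addnn [X in _ <= X + _]exchange_big -big_split /=.
rewrite big_mkcond; apply: leq_sum => A _ /=; case: eqP => // cA.
rewrite -big_split big_mkcond; apply: leq_sum => B _ /=; case: eqP => // cB.
have [//|AB] := eqVneq A B; case: (boolP [disjoint A & B]) => //= meet.
have [i] := cover A B cA cB AB meet.
by rewrite -big_split (bigD1 i) //=; case: (p i A B); case: (p i B A).
Qed.

(** * Box representations *)

Lemma box_representable_nat (R : realType) (G : sgraph) (d : nat)
    (lo hi : 'I_d -> G -> nat) :
  (forall i v, lo i v <= hi i v) ->
  (forall u v, u != v ->
    edge u v = [forall i, (lo i u <= hi i v) && (lo i v <= hi i u)]) ->
  box_representable R G d.
Proof.
move=> lohi edgeE; pose I v i : set R := `[(lo i v)%:R, (hi i v)%:R]%classic%R.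
exists (fun v x => forall i, I v i (x ord0 i)); split=> [v|u v uv].
  by exists (I v) => // i; apply: closed_interval_itv; rewrite ler_nat.
rewrite edgeE //; split=> [/forallP h|[x [xu xv]]].
  (* The larger left end lies in both intervals. *)
  exists (\row_i (maxn (lo i u) (lo i v))%:R)%R.
  split=> i; rewrite /I /= mxE in_itv /= !ler_nat; move: (h i) (lohi i u) (lohi i v); lia.
apply/forallP => i; move: (xu i) (xv i); rewrite /I /= !in_itv /=.
move=> /andP[lu hu] /andP[lv hv]; rewrite -!(ler_nat R).
by rewrite (le_trans lu hv) (le_trans lv hu).
Qed.

(* In the coordinate of a point [i] other than [a] and [b], the sets containing
   [i] are distinct points: first those containing [a], last those containing [b]
   but not [a].  A set avoiding [i] is an interval around the remaining points,
   whose left end skips the first group if the set contains [a] and whose right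
   end skips the last group if it contains [b]. *)
Lemma kneser_box_representable (R : realType) (k n : nat) :
  1 < n -> box_representable R (kneser k n) (n - 2).
Proof.
move=> n2; have an : n - 2 < n by lia. have bn : n - 1 < n by lia.
pose a := Ordinal an; pose b := Ordinal bn.
pose w := widen_ord (leq_subr 2 n); pose V : finType := kneser_vertex k n; pose N := #|V|.
(* The groups occupy the positions below [N], from [N] to [2N - 1], and from [2N + 1] to [3N]; so
   [N] and [2N] are ends that skip a group. *)
pose pos (v : V) := enum_rank v + (if a \in val v then 0 else if b \in val v then N.*2.+1 else N).
pose lo i (v : V) := if w i \in val v then pos v else if a \in val v then N else 0.
pose hi i (v : V) := if w i \in val v then pos v else if b \in val v then N.*2 else (3 * N).+1.
have rkN (v : V) : enum_rank v < N by [].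
apply: (@box_representable_nat R (kneser k n) _ lo hi) => [i v|u v uv].
  rewrite /lo /hi /pos; move: (rkN v).
  by case: (w i \in val v); case: (a \in val v); case: (b \in val v); lia.
have rk : enum_rank (u : V) != enum_rank (v : V) :> nat.
  by apply: contraNneq uv => /val_inj/enum_rank_inj->.
rewrite /edge /= /kneser_edge uv /=; apply/idP/forallP => [dis i|h].
{ have dis' x : x \in val u -> x \notin val v by move=> xu; rewrite (disjointFr dis xu).
  rewrite /lo /hi /pos; move: (rkN u) (rkN v) (dis' (w i)) (dis' a) (dis' b).
  case: (w i \in val u); case: (w i \in val v) => ? ? // h; first by have := h isT.
  all: case: (a \in val u); case: (a \in val v) => // h1; try by have := h1 isT.
  all: case: (b \in val u); case: (b \in val v) => // h2; try by have := h2 isT.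
  all: lia. }
have wP x : x != a -> x != b -> exists i, w i = x.
  move=> xa xb; have xn : x < n - 2.
    have := ltn_ord x; move: xa xb; rewrite -!val_eqE /=; lia.
  by exists (Ordinal xn); apply: val_inj.
have diff (u1 v1 : V) : u1 != v1 -> exists2 y, y \in val u1 & y \notin val v1.
  move=> uv1; apply/subsetPn; apply: contra uv1 => sub; apply/eqP/val_inj/eqP.
  by rewrite eqEcard sub (eqP (valP u1)) (eqP (valP v1)) leqnn.
(* Under the negated condition, a point [y] of [u1] outside [v1] is neither [a] nor [b], and in its
   coordinate [u1] lies in a group that the interval of [v1] skips. *)
have sep (u1 v1 : V) : u1 != v1 ->
    (forall i, (lo i u1 <= hi i v1) && (lo i v1 <= hi i u1)) ->
    ~~ (if a \in val u1 then (a \in val v1) && ((b \in val u1) ==> (b \in val v1))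
        else (b \in val u1) && (b \in val v1)).
  move=> uv1 h1; apply/negP => ab; have [y yu yv] := diff _ _ uv1.
  have [||i iy] := wP y.
  - by apply: contraNneq yv => ya; move: ab; rewrite -ya yu => /andP[].
  - apply: contraNneq yv => yb; move: ab; rewrite -yb yu.
    by case: ifP => _ /=; [case/andP|].
  have := h1 i; rewrite /lo /hi iy yu (negPf yv) /pos; move: ab (rkN u1).
  case: (a \in val u1) => /andP[-> bv]; first by lia.
  by rewrite bv; lia.
have vu : v != u by rewrite eq_sym.
have hC i : (lo i v <= hi i u) && (lo i u <= hi i v) by rewrite andbC.
apply/pred0P => x /=; apply/negP => /andP[xu xv].
have xab : (x == a) || (x == b).
  apply: contraLR rk; rewrite negb_or negbK => /andP[xa xb].
  have [i ix] := wP x xa xb; have := h i; rewrite /lo /hi ix xu xv /pos.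
  move: (rkN u) (rkN v).
  by case: (a \in val u); case: (a \in val v); case: (b \in val u); case: (b \in val v); lia.
move: (sep u v uv h) (sep v u vu hC); case/orP: xab xu xv => /eqP-> -> ->.
  by case: (b \in val u); case: (b \in val v).
by rewrite !implybT !andbT; case: (a \in val u); case: (a \in val v).
Qed.

(** * From box representations to Ferrers relations *)

Definition entirely_before (R : realType) (I J : set R) : Prop :=
  forall x y, I x -> J y -> (x < y)%R.

(** The negations give [y <= x] and [x' <= y'] with [x], [x'] in [I] and [y], [y'] in [J]; the
    larger of [x'] and [y] lies in both. *)
Lemma intervals_meet (R : realType) (I J : set R) :
  is_interval I -> is_interval J ->
  ~ entirely_before I J -> ~ entirely_before J I -> exists z, I z /\ J z.
Proof.
move=> itvI itvJ; rewrite /entirely_before.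
move=> /existsNP[x /existsNP[y /not_implyP[Ix /not_implyP[Jy /negP]]]]; rewrite -leNgt => yx.
move=> /existsNP[y' /existsNP[x' /not_implyP[Jy' /not_implyP[Ix' /negP]]]].
rewrite -leNgt => xy'; have [x'y|yx'] := leP x' y.
  by exists y; split=> //; apply: (itvI x' x) => //; rewrite x'y yx.
by exists x'; split=> //; apply: (itvJ y y') => //; rewrite xy' (ltW yx').
Qed.

(** If [y' <= x] with [x] in [I] and [y'] in [J'], then [I'] lies left of [y'] and [J] right of
    [x]. *)
Lemma entirely_before_ferrers (R : realType) (I J I' J' : set R) :
  entirely_before I J -> entirely_before I' J' -> (exists y, J y) ->
  entirely_before I J' \/ entirely_before I' J.
Proof.
move=> IJ I'J' [y Jy]; case: (pselect (entirely_before I J')) => [|h]; [by left|right].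
move: h => /existsNP[x /existsNP[y' /not_implyP[Ix /not_implyP[Jy' /negP]]]].
rewrite -leNgt => y'x x' z I'x' Jz.
by apply: lt_trans (IJ x z Ix Jz); apply: lt_le_trans y'x; exact: I'J'.
Qed.

Lemma kneser_coordinates (R : realType) (k n d : nat) :
  box_representable R (kneser k n) d ->
  exists p : 'I_d -> rel {set 'I_n}, [/\ forall i, ferrers (p i),
    forall i, kmeeting k (p i) &
    forall A B : {set 'I_n}, #|A| = k -> #|B| = k -> A != B -> ~~ [disjoint A & B] ->
      exists i, p i A B || p i B A].
Proof.
move=> [B [boxB edgeB]].
have /choice[I IB] : forall v, exists J : 'I_d -> set R,
    (forall i, closed_interval (J i)) /\ B v = (fun x => forall i, J i (x ord0 i)).
  by move=> v; have [J ? ?] := boxB v; exists J.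
pose before i u v := entirely_before (I u i) (I v i).
(* Sets of size other than [k] are related to nothing, so the relation can live on all of
   [{set 'I_n}]. *)
exists (fun i A A' => `[< exists u v : kneser k n,
  [/\ val u = A, val v = A' & before i u v] >]); split.
- move=> i A1 A2 A3 A4 /asboolP[u1 [u2 [<- <- h12]]] /asboolP[u3 [u4 [<- <- h34]]].
  have [J20 _ _] := (IB u2).1 i.
  have [h|h] := entirely_before_ferrers h12 h34 J20; apply/orP; [left|right].
    by apply/asboolP; exists u1, u4.
  by apply/asboolP; exists u3, u2.
- move=> i A1 A2 /asboolP[u [v [<- <- uv]]].
  have [[x Iux] _ _] := (IB u).1 i.
  have neuv : u != v.
    by apply/eqP => E; move: (uv x x); rewrite -E ltxx => /(_ Iux Iux).
  split; [exact/eqP/(valP u)|exact/eqP/(valP v)|by apply: contra neuv => /eqP/val_inj->|].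
  apply/negP => dis; have [+ _] := edgeB u v neuv.
  rewrite /edge /= /kneser_edge neuv dis => /(_ isT)[y []].
  rewrite (IB u).2 (IB v).2 => /(_ i) Iy /(_ i) Jy.
  by have := uv _ _ Iy Jy; rewrite ltxx.
move=> A1 A2 c1 c2 neA meet.
pose u : kneser k n := exist _ A1 (introT eqP c1).
pose v : kneser k n := exist _ A2 (introT eqP c2).
have neuv : u != v by rewrite -val_eqE.
apply: contrapT => none; move: meet; apply/negP/negPn.
(* If no coordinate separates the boxes, common points chosen coordinatewise form a point of both,
   forcing an edge. *)
have /choice[z zI] : forall i, exists t, I u i t /\ I v i t.
  move=> i.
  have [_ Iu _] := (IB u).1 i; have [_ Iv _] := (IB v).1 i.
  apply: intervals_meet => // h; apply: none; exists i; apply/orP; [left|right].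
    by apply/asboolP; exists u, v.
  by apply/asboolP; exists v, u.
have : edge u v.
  apply/edgeB => //; exists (\row_i z i)%R.
  by rewrite (IB u).2 (IB v).2; split=> i; rewrite mxE; case: (zI i).
by rewrite /edge /= /kneser_edge => /andP[].
Qed.

Local Open Scope ring_scope.

Theorem theorem1p1 (R : realType) (k n : nat)
    (hk : (0 < k)%N) (hn : (2 * k + 1 <= n)%N) :
  (boxicity R (kneser k n) <= n - 2)%N /\
  ((2 <= k)%N -> (2 * k ^ 3 - 2 * k ^ 2 + 1 <= n)%N ->
   n%:R - (13 * k%:R ^+ 2 - 11 * k%:R + 16) / 2
     <= (boxicity R (kneser k n))%:R :> R).
Proof.
rewrite /boxicity; case: ex_minnP => d /asboolP drep dmin.
(* This also supplies the bound [d <= n] for the counting argument. *)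
have dn : (d <= n - 2)%N.
  by apply/dmin/asboolP/kneser_box_representable; lia.
split=> // k2 kn; have [p [pF pk cover]] := kneser_coordinates drep.
have : (2 * n + 11 * k <= 2 * d + 13 * k ^ 2 + 16)%N.
  have := @ferrers_cover_bound _ k d p k2; rewrite card_ord; apply=> //; lia.
by rewrite -(ler_nat R) -!mulnn !natrD !natrM; lra.
Qed.
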